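(* For all sufficiently large $n$, there exists a multigraph $G$ which simultaneously maximizes $P$ over $D(n)$ and maximizes $P$ over $W(n)$ (in particular $G\in W(n)$).
   Context: A multigraph is $(V,w)$ with $w:\binom V2\to\mathbb{N}$; $\mu(G)=\max w$, $P(G)=\prod_{xy}w(xy)$. An $(s,q)$-graph is a multigraph in which every $s$ vertices span total multiplicity at most $q$; $F(n,s,q)$ is the set of $(s,q)$-graphs on $[n]$. $D(n)=\{G\in F(n,4,15):\mu(G)\le 3\}\cap F(n,3,8)$. $W(n)$ is the set of multigraphs $([n],w)$ for which there is a partition $L,R$ of $[n]$ with $w=1$ on $\binom L2$, $w=2$ on $\binom R2$, $w=3$ on pairs between $L$ and $R$. *)

(* Defs.v *)
From mathcomp Require Import all_boot.

Set Implicit Arguments.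
Unset Strict Implicit.
Unset Printing Implicit Defensive.

Definition edge (V : finType) := {e : {set V} | #|e| == 2}.

Definition multigraph (V : finType) := {ffun edge V -> nat}.

Definition mu (V : finType) (w : multigraph V) : nat :=
  \max_(e : edge V) w e.

Definition P (V : finType) (w : multigraph V) : nat :=
  \prod_(e : edge V) w e.

Definition span_weight (V : finType) (w : multigraph V) (A : {set V}) : nat :=
  \sum_(e : edge V | val e \subset A) w e.

Definition sq_graph (V : finType) (s q : nat) (w : multigraph V) : Prop :=
  forall A : {set V}, #|A| = s -> span_weight w A <= q.

(* Families of multigraphs on [n] are predicates on multigraph 'I_n. *)
Definition F (n s q : nat) (w : multigraph 'I_n) : Prop := sq_graph s q w.

Definition D (n : nat) (w : multigraph 'I_n) : Prop :=
  (F 4 15 w /\ mu w <= 3) /\ F 3 8 w.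

(* A part of the partition L, R may be empty. *)
Definition W (n : nat) (w : multigraph 'I_n) : Prop :=
  exists L R : {set 'I_n},
    [/\ L :|: R = setT /\ [disjoint L & R],
        forall e : edge 'I_n, val e \subset L -> w e = 1,
        forall e : edge 'I_n, val e \subset R -> w e = 2
      & forall (e : edge 'I_n) (x y : 'I_n),
          x \in L -> y \in R -> val e = [set x; y] -> w e = 3].

Definition maximizes_P (n : nat) (S : multigraph 'I_n -> Prop)
    (w : multigraph 'I_n) : Prop :=
  S w /\ forall w' : multigraph 'I_n, S w' -> P w' <= P w.

(* Main.v *)
Require Import Defs.
From mathcomp Require Import all_boot.
From mathcomp Require Import zify.

(* A weight with values 1, 2, 3 is in D iff its 3-edges have no triangle and every
   4-cycle of 3-edges has a diagonal of weight 1.  With weight 1 on the diagonal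
   this condition is stable under pulling back along arbitrary maps, so vertices
   may be cloned, two clones having weight 1.  Hence, in a maximal weight, weight
   1 is an equivalence relation, and all vertices have the same product degree up
   to a factor 3.  Comparing with the graph of W with #|L| = n/4 shows that every
   vertex v satisfies 12 N(v) >= 3 n + 20 s(v), where s(v) is the size of the
   class of v and N(v) the number of its 3-neighbours.  As the 3-neighbours of v
   taken in distinct classes have 3-neighbourhoods meeting only inside the class
   of v, counting forces s(v) >= n/4 for some v.  Make the class of v consist of
   clones of v; then counting again, every vertex outside it is a 3-neighbour of
   v, so the weight is dominated by the graph of W with L the class of v. *)

Set Implicit Arguments.
Unset Strict Implicit.
Unset Printing Implicit Defensive.

(** * Admissible weightings and pull-backs *)

Section Weightings.

Variable V : finType.
Implicit Types (f g : V -> V -> nat) (x y z t : V) (A L : {set V}).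

(** The diagonal value 1 is neutral in products and gives two clones of a vertex weight 1. The
    quantified vertices may coincide, which is why pulling back along a non-injective map is
    harmless. *)
Definition admissible f : bool :=
  [&& [forall x, f x x == 1],
      [forall x, forall y, f x y == f y x],
      [forall x, forall y, 0 < f x y <= 3],
      [forall x, forall y, forall z,
         ~~ [&& f x y == 3, f y z == 3 & f x z == 3]]
    & [forall x, forall y, forall z, forall t,
         [&& f x y == 3, f y z == 3, f z t == 3 & f t x == 3] ==>
         (f x z == 1) || (f y t == 1)]].

Lemma admissibleP f :
  reflect [/\ forall x, f x x = 1,
              forall x y, f x y = f y x,
              forall x y, 0 < f x y <= 3,
              forall x y z, f x y = 3 -> f y z = 3 -> f x z <> 3
            & forall x y z t, f x y = 3 -> f y z = 3 -> f z t = 3 ->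
                f t x = 3 -> f x z = 1 \/ f y t = 1]
          (admissible f).
Proof.
apply: (iffP and5P) => [[h1 h2 h3 h4 h5]|[h1 h2 h3 h4 h5]]; split.
- by move=> x; apply/eqP; apply: (forallP h1).
- by move=> x y; apply/eqP; apply: (forallP (forallP h2 x)).
- by move=> x y; apply: (forallP (forallP h3 x)).
- move=> x y z xy yz xz; move/forallP: h4 => /(_ x)/forallP/(_ y)/forallP/(_ z).
  by rewrite xy yz xz.
- move=> x y z t xy yz zt tx.
  move/forallP: h5 => /(_ x)/forallP/(_ y)/forallP/(_ z)/forallP/(_ t).
  by rewrite xy yz zt tx /= => /orP[]/eqP ->; [left|right].
- by apply/forallP => x; apply/eqP.
- by apply/forallP => x; apply/forallP => y; apply/eqP.
- by apply/forallP => x; apply/forallP => y.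
- apply/forallP => x; apply/forallP => y; apply/forallP => z.
  apply/negP => /and3P[/eqP xy /eqP yz /eqP xz]; exact: (h4 x y z).
- apply/forallP => x; apply/forallP => y; apply/forallP => z; apply/forallP => t.
  apply/implyP => /and4P[/eqP xy /eqP yz /eqP zt /eqP tx].
  by case: (h5 x y z t) => // ->; rewrite eqxx ?orbT.
Qed.

Lemma admissible_pull (p : V -> V) f :
  admissible f -> admissible (fun x y => f (p x) (p y)).
Proof.
case/admissibleP => h1 h2 h3 h4 h5; apply/admissibleP; split=> //.
- by move=> x y z; apply: h4.
- by move=> x y z t; apply: h5.
Qed.

(** * Product degrees and maximal weightings *)

Definition deg f x := \prod_y f x y.

Definition total f := \prod_x deg f x.

(** Pairs inside [A] contribute 1, and each pair between [A] and its complement is counted in both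
    orders, whence the square. *)
Lemma total_split f A :
    (forall x y, f x y = f y x) -> {in A &, forall x y, f x y = 1} ->
  total f = (\prod_(x in ~: A) \prod_(y in ~: A) f x y)
            * (\prod_(x in A) deg f x) ^ 2.
Proof.
move=> fC fA; rewrite /total (bigID (mem A)) /= mulnC -mulnn mulnA.
congr (_ * _).
have -> : \prod_(x in A) deg f x = \prod_(x in ~: A) \prod_(y in A) f x y.
  rewrite [RHS]exchange_big /=; apply: eq_bigr => x xA.
  rewrite /deg (bigID (mem A)) /= big1 => [|y yA]; last exact: fA.
  by rewrite mul1n; apply: eq_big => y; rewrite ?inE // => _; apply: fC.
rewrite -big_split /=; apply: eq_big => x; rewrite ?inE // => _.
rewrite /deg (bigID (mem A)) /= mulnC; congr (_ * _).
by apply: eq_bigl => y; rewrite inE.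
Qed.

Definition maximal f :=
  admissible f /\ forall g, admissible g -> total g <= total f.

(** Admissible values are at most 3, so weightings can be encoded as maps into ['I_4]; these form a
    finite type, where a maximum exists. *)
Lemma maximal_exists f :
  admissible f -> exists2 g, maximal g & total f <= total g.
Proof.
move=> af.
pose val_of (g : {ffun V * V -> 'I_4}) x y : nat := g (x, y).
have enc g : admissible g -> exists2 h, admissible (val_of h) &
    total (val_of h) = total g.
  move=> ag; have /admissibleP[h1 h2 h3 h4 h5] := ag.
  pose h : {ffun V * V -> 'I_4} := [ffun p => inord (g p.1 p.2)].
  have hE x y : val_of h x y = g x y.
    by rewrite /val_of ffunE inordK //= ltnS; case/andP: (h3 x y).
  exists h; last by apply: eq_bigr => x _; apply: eq_bigr => y _.
  apply/admissibleP; split.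
  - by move=> x; rewrite hE.
  - by move=> x y; rewrite !hE.
  - by move=> x y; rewrite !hE.
  - by move=> x y z; rewrite !hE; apply: h4.
  - by move=> x y z t; rewrite !hE; apply: h5.
have [h0 ah0 eh0] := enc f af.
pose m := [arg max_(h > h0 | admissible (val_of h)) total (val_of h)].
have [am mmax] : admissible (val_of m) /\ forall h, admissible (val_of h) ->
    total (val_of h) <= total (val_of m).
  by rewrite /m; case: arg_maxnP.
exists (val_of m); last by rewrite -eh0; apply: mmax.
by split=> // g /enc[h ah <-]; apply: mmax.
Qed.

(** * Cloning in a maximal weighting *)

Lemma total_clone f A v (p := fun x => if x \in A then v else x) :
    admissible f -> {in A &, forall x y, f x y = 1} ->
  total (fun x y => f (p x) (p y))
  = (\prod_(x in ~: A) \prod_(y in ~: A) f x y)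
    * ((\prod_(y in ~: A) f v y) ^ #|A|) ^ 2.
Proof.
move=> af fA; have /admissibleP[h1 h2 h3 h4 h5] := af.
rewrite (@total_split (fun x y => f (p x) (p y)) A).
- congr (_ * _ ^ 2).
    apply: eq_bigr => x; rewrite inE => /negPf xA.
    by apply: eq_bigr => y; rewrite inE => /negPf yA; rewrite /p xA yA.
  rewrite -prod_nat_const; apply: eq_bigr => x xA.
  rewrite /deg (bigID (mem A)) /= [X in X * _]big1 ?mul1n => [|y yA].
    apply: eq_big => y; rewrite ?inE // => /negPf yA.
    by rewrite /p xA yA.
  by rewrite /p xA yA.
- by move=> x y; apply: h2.
- by move=> x y xA yA; rewrite /p xA yA.
Qed.

(** Turning all of [A] into clones of [v] leaves the pairs outside [A] alone, so their positive
    product cancels. *)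
Lemma maximal_clone_le f A v : maximal f ->
    {in A &, forall x y, f x y = 1} ->
  (\prod_(y in ~: A) f v y) ^ #|A| <= \prod_(x in A) deg f x.
Proof.
move=> [af fmax] fA; have /admissibleP[h1 h2 h3 h4 h5] := af.
have := fmax _ (admissible_pull (fun x => if x \in A then v else x) af).
rewrite (total_split h2 fA) (total_clone v af fA) leq_pmul2l ?leq_exp2r //.
apply: prodn_cond_gt0 => x _; apply: prodn_cond_gt0 => y _.
by case/andP: (h3 x y).
Qed.

Lemma maximal_clone f A v (p := fun x => if x \in A then v else x) :
    maximal f -> {in A &, forall x y, f x y = 1} ->
    \prod_(x in A) deg f x <= (\prod_(y in ~: A) f v y) ^ #|A| ->
  maximal (fun x y => f (p x) (p y)).
Proof.
move=> [af fmax] fA le; have /admissibleP[h1 h2 h3 h4 h5] := af.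
split=> [|g ag]; first exact: admissible_pull.
apply: leq_trans (fmax g ag) _.
by rewrite (total_split h2 fA) total_clone // leq_mul2l leq_exp2r // le orbT.
Qed.

Lemma degD1 f x y : f x y * \prod_(z in ~: [set y]) f x z = deg f x.
Proof.
by rewrite /deg [RHS](bigD1 y) //=; congr (_ * _); apply: eq_bigl => z; rewrite !inE.
Qed.

(** Here [y] is overwritten by a clone of [x]; the factor [f x y] is the one that the clone
    loses. *)
Lemma maximal_deg_le f x y : maximal f -> deg f x <= f x y * deg f y.
Proof.
move=> mf; have /admissibleP[h1 _ _ _ _] := mf.1.
have := @maximal_clone_le f [set y] x mf; rewrite cards1 expn1 big_set1.
rewrite -(degD1 f x y) leq_mul2l => -> //; first by rewrite orbT.
by move=> a b /set1P-> /set1P->.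
Qed.

Lemma maximal_deg_eq f x y : maximal f -> f x y = 1 -> deg f x = deg f y.
Proof.
move=> mf xy; have /admissibleP[_ h2 _ _ _] := mf.1.
apply/eqP; rewrite eqn_leq -{1}[deg f y]mul1n -[X in _ && (_ <= X)]mul1n.
by rewrite -{1}xy -xy {2}h2 !maximal_deg_le.
Qed.

(* After cloning x from y, both y and z still have weight 1 towards each other,
   so the degree of z must not have changed, i.e. f z x = 1. *)
Lemma maximal_trans f x y z :
  maximal f -> f x y = 1 -> f y z = 1 -> f x z = 1.
Proof.
move=> mf xy yz; have /admissibleP[h1 h2 h3 _ _] := mf.1.
have [->//|xDy] := eqVneq x y; have [->//|zDx] := eqVneq z x.
have fA : {in [set x] &, forall a b, f a b = 1}.
  by move=> a b /set1P-> /set1P->.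
have := @maximal_clone f [set x] y mf fA.
rewrite big_set1 cards1 expn1 => mg.
pose p a := if a \in [set x] then y else a.
have {}mg : maximal (fun a b => f (p a) (p b)).
  by apply: mg; rewrite (maximal_deg_eq mf xy) -(degD1 f y x) h2 xy mul1n.
have pE a : a != x -> p a = a by rewrite /p inE => /negPf->.
have px : p x = y by rewrite /p set11.
have py : p y = y by apply: pE; rewrite eq_sym.
have pz : p z = z by apply: pE.
have := maximal_deg_eq (x := y) (y := z) mg.
rewrite py pz => /(_ yz).
rewrite -(degD1 _ y x) -(degD1 _ z x) /= py pz px h1 (h2 z) yz.
have E a : \prod_(b in ~: [set x]) f a (p b) = \prod_(b in ~: [set x]) f a b.
  by apply: eq_bigr => b; rewrite !inE => /pE->.
rewrite !E !mul1n => e.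
have := maximal_deg_eq mf yz; rewrite -(degD1 f y x) -(degD1 f z x) h2 xy mul1n e.
rewrite -[LHS]mul1n (h2 z x) => /eqP; rewrite eqn_pmul2r => [/eqP//|].
by apply: prodn_cond_gt0 => b _; case/andP: (h3 z b).
Qed.

(** * Classes, 3-neighbourhoods and the comparison weights *)

Definition cls f x := [set y | f x y == 1].
Definition nbr f x := [set y | f x y == 3].

(** A factor 2 comes from each vertex outside both sets; multiplying across avoids a subtraction in
    the exponent. *)
Lemma deg_exp f x : admissible f ->
  deg f x * 2 ^ (#|cls f x| + #|nbr f x|) = 2 ^ #|V| * 3 ^ #|nbr f x|.
Proof.
case/admissibleP=> h1 h2 h3 _ _.
have cE (A : {set V}) b : b ^ #|A| = \prod_y (if y \in A then b else 1).
  by rewrite -big_mkcond prod_nat_const.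
rewrite expnD !cE /deg -[2 ^ #|V|]prod_nat_const.
rewrite -!big_split; apply: eq_big => // y _; rewrite !inE /=.
by have := h3 x y; case: (f x y) => [|[|[|[|?]]]].
Qed.

Lemma card_clsU_nbr f x :
  #|cls f x :|: nbr f x| = #|cls f x| + #|nbr f x|.
Proof.
rewrite cardsU; have -> : cls f x :&: nbr f x = set0; last by rewrite cards0 subn0.
by apply/setP=> y; rewrite !inE; case: eqP => // ->.
Qed.

Definition split_weight L x y :=
  if x == y then 1 else
  if (x \in L) && (y \in L) then 1 else
  if (x \in L) || (y \in L) then 3 else 2.

(** The 3-pairs are bipartite between [L] and its complement, so no triangle occurs and every
    4-cycle has a diagonal inside [L]. *)
Lemma admissible_split L : admissible (split_weight L).
Proof.
apply/admissibleP; rewrite /split_weight; split.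
- by move=> x; rewrite eqxx.
- by move=> x y; rewrite eq_sym andbC orbC.
- by move=> x y; do !case: ifP.
- by move=> x y z; do 3!case: eqVneq => //= _; do 3!case: (_ \in L).
- move=> x y z t; do 6!case: eqVneq => //= _; try by [left|right].
  all: do 4!case: (_ \in L) => //=; try by [left|right].
Qed.

Lemma total_split_weight L :
  total (split_weight L)
  = (3 ^ #|~: L|) ^ #|L| * (3 ^ #|L| * 2 ^ #|~: L|.-1) ^ #|~: L|.
Proof.
rewrite /total (bigID (mem L)) /=; congr (_ * _); rewrite -prod_nat_const.
  apply: eq_bigr => x xL; rewrite /deg (bigID (mem L)) /= big1 ?mul1n => [|y yL].
    rewrite -prod_nat_const; apply: eq_big => y; rewrite ?inE // => yL.
    by rewrite /split_weight xL (negPf yL); case: eqVneq yL => // <-; rewrite xL.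
  by rewrite /split_weight xL yL; case: ifP.
apply: eq_big => x; rewrite ?inE // => xL; rewrite /deg (bigID (mem L)) /=.
congr (_ * _).
  rewrite -prod_nat_const; apply: eq_bigr => y yL.
  by rewrite /split_weight (negPf xL) yL; case: eqVneq xL => // ->; rewrite yL.
(* The predecessor accounts for the diagonal, whose value is 1 and not 2. *)
have -> : #|~: L|.-1 = #|~: L :\ x| by rewrite (cardsD1 x (~: L)) inE xL.
rewrite (bigD1 x) //= {1}/split_weight eqxx mul1n -prod_nat_const.
apply: eq_big => y; rewrite ?inE 1?andbC // => /andP[yDx yL].
by rewrite /split_weight (negPf xL) (negPf yL) eq_sym (negPf yDx).
Qed.

Lemma exists_card k : k <= #|V| -> exists A : {set V}, #|A| = k.
Proof.
move=> le; exists [set x in take k (enum V)].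
by rewrite cardsE (card_uniqP _) ?take_uniq ?enum_uniq // size_takel -?cardE.
Qed.

(** * Lower bound for the 3-neighbourhoods *)

Lemma nbr_bound_arith l r n s N c : c < 4 -> 500 <= l ->
    n = 4 * l + c -> r = 3 * l + c ->
    110 * (l * r) + 35 * (r * r.-1) + 35 * (n * s)
      <= 7 * n * (5 * n + 3 * N + 8) ->
  3 * n + 20 * s <= 12 * N.
Proof.
move=> c4 l500 nE rE e; rewrite leqNgt; apply/negP => lt.
have lt' : n * (12 * N + 1) <= n * (3 * n + 20 * s).
  by rewrite leq_mul2l addn1 lt orbT.
have rr : r * r = r * r.-1 + r by rewrite -mulnSr prednK // rE; lia.
(* The terms in [n * s] cancel between the two inequalities. *)
have e1 : 440 * (l * r) + 140 * (r * r) <= 161 * (n * n) + 217 * n + 140 * r.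
  by clear nE rE; lia.
have ll : 500 * l <= l * l by rewrite leq_mul2r l500 orbT.
(* The quadratic terms are now [2580 * l ^ 2] against [2576 * l ^ 2]; the small surplus beats the
   linear terms once [l] is at least 500. *)
by move: e1; rewrite nE rE; case: c c4 {nE rE} => [|[|[|[|//]]]] _ e1; lia.
Qed.

(* The comparison weight splits off a quarter of the vertices; log_2 3 is only
   used through 11/7 <= log_2 3 <= 8/5. *)
Lemma maximal_nbr_large f v : 2000 <= #|V| -> maximal f ->
  3 * #|V| + 20 * #|cls f v| <= 12 * #|nbr f v|.
Proof.
move=> n_large mf; have /admissibleP[_ _ h3 _ _] := mf.1.
have [L cL] := exists_card (leq_div #|V| 4).
have := mf.2 _ (admissible_split L); rewrite total_split_weight.
have cLC : #|~: L| = #|V| - #|V| %/ 4 by rewrite cardsCs setCK cL.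
rewrite cL cLC.
set n := #|V| in n_large *; set l := n %/ 4; set r := n - l.
have := deg_exp v mf.1; rewrite -/n.
set d := deg f v; set s := #|cls f v|; set N := #|nbr f v| => d_exp.
move=> le.
(* Every degree is at most [3 * d], since weights are at most 3. *)
have {}le : (3 ^ (2 * l * r) * 2 ^ (r * r.-1)) <= (3 * d) ^ n.
  have -> : 3 ^ (2 * l * r) * 2 ^ (r * r.-1)
          = (3 ^ r) ^ l * (3 ^ l * 2 ^ r.-1) ^ r.
    rewrite expnMn -!expnM mulnA -expnD; congr (3 ^ _ * 2 ^ _); lia.
  apply: leq_trans le _; rewrite -prod_nat_const.
  apply: leq_prod => x _; apply: leq_trans (maximal_deg_le x v mf) _.
  by rewrite leq_mul2r; case/andP: (h3 x v) => _ ->; rewrite orbT.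
(* This uses [3 ^ 5 <= 2 ^ 8], applied [N.+1] times: [N] times for the 3-neighbours and once for the
   factor 3 before [d]. *)
have d5 : (3 * d) ^ 5 * 2 ^ (5 * s) <= 2 ^ (5 * n + 3 * N + 8).
  rewrite -(leq_pmul2r (expn_gt0 2 (5 * N))).
  have -> : (3 * d) ^ 5 * 2 ^ (5 * s) * 2 ^ (5 * N)
          = 3 ^ 5 * (d * 2 ^ (s + N)) ^ 5.
    move: (5) => k.
    by rewrite expnMn -!mulnA -expnD -mulnDr (mulnC k) expnM -expnMn.
  rewrite d_exp expnMn -!expnM mulnCA mulnC -expnD.
  have -> : 2 ^ (5 * n + 3 * N + 8) * 2 ^ (5 * N) = (2 ^ 8) ^ (N.+1) * 2 ^ (n * 5).
    rewrite -!expnM -!expnD; congr (2 ^ _); lia.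
  rewrite leq_mul2r; apply/orP; right.
  have -> : 5 + N * 5 = 5 * N.+1 by lia.
  by rewrite expnM leq_exp2r.
have pow a b c e k : a ^ b * 2 ^ c <= 2 ^ e ->
    a ^ (b * k) * 2 ^ (c * k) <= 2 ^ (e * k).
  by rewrite !expnM -expnMn => h; case: k => // k; rewrite leq_exp2r.
(* The power 35 serves both the fifth power in [d5] and the seventh in [2 ^ 11 <= 3 ^ 7]. *)
have e : 2 ^ (110 * (l * r) + 35 * (r * r.-1) + 35 * (n * s))
         <= 2 ^ (7 * n * (5 * n + 3 * N + 8)).
  have le1 : (3 * d) ^ (35 * n) * 2 ^ (35 * (n * s))
             <= 2 ^ (7 * n * (5 * n + 3 * N + 8)).
    have -> : 35 * n = 5 * (7 * n) by lia.
    have -> : 35 * (n * s) = 5 * s * (7 * n) by lia.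
    rewrite [7 * n * _]mulnC; apply: pow; exact: d5.
  apply: leq_trans le1; rewrite expnD leq_mul2r; apply/orP; right.
  rewrite (mulnC 35 n) [X in _ <= X]expnM.
  have /(leq_trans _) : (3 ^ (2 * l * r) * 2 ^ (r * r.-1)) ^ 35
                        <= ((3 * d) ^ n) ^ 35 by rewrite leq_exp2r.
  apply; rewrite expnMn -!expnM expnD (mulnC (r * _) 35) leq_mul2r; apply/orP; right.
  have -> : 2 * l * r * 35 = 7 * (10 * (l * r)) by lia.
  have -> : 110 * (l * r) = 11 * (10 * (l * r)) by lia.
  have base : 2 ^ 11 <= 3 ^ 7 by vm_compute.
  have mono a b k : a <= b -> a ^ k <= b ^ k.
    by case: k => // k h; rewrite leq_exp2r.
  rewrite (expnM 2 11) (expnM 3 7); exact: mono base.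
move: e; rewrite leq_exp2l // => e.
have [c [cn ne]] : exists c, c < 4 /\ n = 4 * l + c.
  by exists (n %% 4); split; [rewrite ltn_mod | rewrite [LHS](divn_eq n 4) mulnC].
have re : r = 3 * l + c.
  by rewrite /r [in LHS]ne -[4 * l]/(3.+1 * l) mulSn -addnA addKn.
apply: (nbr_bound_arith cn _ ne re e).
by rewrite leq_divRL // (leq_trans _ n_large).
Qed.

(** * Counting over the classes that meet a 3-neighbourhood *)

Lemma card_le_sum_cover (S T : {set V}) (B : V -> {set V}) :
    (forall x, x \in S -> exists2 t, t \in T & x \in B t) ->
  #|S| <= \sum_(t in T) #|B t|.
Proof.
move=> cover; have -> : \sum_(t in T) #|B t| = \sum_x \sum_(t in T) (x \in B t).
  by rewrite exchange_big; apply: eq_bigr => t _; rewrite -sum1_card big_mkcond.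
rewrite -sum1_card big_mkcond; apply: leq_sum => x _; case: ifP => // /cover[t tT xt].
by rewrite (bigD1 t) //= xt.
Qed.

Lemma sum_card_disjoint_le (S T : {set V}) (B : V -> {set V}) :
    {in T, forall t, B t \subset S} ->
    (forall x t t', t \in T -> t' \in T -> x \in B t -> x \in B t' -> t = t') ->
  \sum_(t in T) #|B t| <= #|S|.
Proof.
move=> sub inj.
have -> : \sum_(t in T) #|B t| = \sum_x \sum_(t in T) (x \in B t).
  by rewrite exchange_big; apply: eq_bigr => t _; rewrite -sum1_card big_mkcond.
rewrite -[#|S|]sum1_card [X in _ <= X]big_mkcond; apply: leq_sum => x _.
case: (boolP [exists t in T, x \in B t]) => [/exists_inP[t tT xt]|].
  rewrite (subsetP (sub _ tT)) // (bigD1 t) //= xt big1 // => t' /andP[t'T].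
  by apply: contraNeq; case: (boolP (x \in B t')) => // xt' _; rewrite (inj x t t').
move=> /exists_inPn nx; rewrite big1 // => t tT; by rewrite (negPf (nx t tT)).
Qed.

(* A 3-4-cycle v t x t' with f t t' <> 1 forces f v x = 1, so the
   3-neighbourhoods of pairwise inequivalent 3-neighbours of v only overlap
   inside the class of v. *)
Lemma maximal_transversal f v : maximal f ->
  exists T : {set V}, [/\ T \subset nbr f v,
      #|nbr f v| <= \sum_(t in T) #|cls f t|
    & \sum_(t in T) #|nbr f t :\: cls f v| + #|cls f v| + #|nbr f v| <= #|V| ].
Proof.
move=> mf; have /admissibleP[h1 h2 h3 h4 h5] := mf.1.
pose P (T : {set V}) := (T \subset nbr f v) &&
  [forall t in T, forall t' in T, (f t t' == 1) ==> (t == t')].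
have [|T /maxsetP[/andP[TN Tind] Tmax] _] := @maxset_exists _ P set0.
  by rewrite /P sub0set; apply/forall_inP => t; rewrite inE.
have {}Tind t t' : t \in T -> t' \in T -> f t t' = 1 -> t = t'.
  move=> tT t'T /eqP e; apply/eqP.
  by move/forall_inP: Tind => /(_ t tT)/forall_inP/(_ t' t'T)/implyP/(_ e).
exists T; split=> //.
- apply: card_le_sum_cover => u uN.
  case: (boolP [exists t in T, u \in cls f t]) => [/exists_inP//|/exists_inPn nu].
  (* A 3-neighbour inequivalent to all of [T] could be added to it, so by maximality it already
     belongs to [T]. *)
  have uT : u \in T.
    rewrite -(Tmax (u |: T)) ?setU11 ?subsetUr //.
    rewrite /P subUset sub1set uN TN /=.
    apply/forall_inP => t /setU1P[->|tT]; apply/forall_inP => t' /setU1P[->|t'T].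
    + by rewrite eqxx implybT.
    + by have := nu t' t'T; rewrite inE h2 => /negPf->.
    + by have := nu t tT; rewrite inE => /negPf->.
    + by apply/implyP => /eqP e; rewrite (Tind t t').
  by exists u => //; rewrite inE h1.
have Nv t : t \in T -> f v t = 3 by move/(subsetP TN); rewrite inE => /eqP.
have -> : #|V| = #|~: (cls f v :|: nbr f v)| + (#|cls f v| + #|nbr f v|).
  by rewrite -(cardsC (cls f v :|: nbr f v)) addnC card_clsU_nbr.
rewrite -addnA leq_add2r; apply: sum_card_disjoint_le => [t tT|x t t' tT t'T].
  apply/subsetP => x; rewrite !inE negb_or => /andP[-> /eqP tx] /=.
  by apply/eqP; apply: (h4 v t x) => //; apply: Nv.
rewrite !inE => /andP[/eqP vx /eqP tx] /andP[_ /eqP t'x]; apply: Tind => //.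
by case: (h5 v t x t'); rewrite ?(h2 x t') ?(h2 t' v) ?(Nv t) ?(Nv t').
Qed.

(** Here [d] is the size of a transversal. As [12 * s <= 3 * n], all but one of the [d] terms may be
    dropped; what is left is [32 * N <= 9 * n], to be compared with the lower bound for [N]. *)
Lemma class_bound_arith n d s N : 0 < d ->
    d * (3 * n) + 20 * N + 12 * s + 12 * N <= 12 * n + d * (12 * s) ->
    3 * n + 20 * s <= 12 * N -> 4 * s <= n ->
  160 * s <= 3 * n.
Proof.
case: d => // d _; rewrite !(mulSn d) => kd Nl small.
have : d * (12 * s) <= d * (3 * n) by rewrite leq_mul2l; lia.
lia.
Qed.

(** Otherwise [N >= n / 4] forces [d >= 14]; keeping 14 of the [d] terms gives [30 * n <= 156 * s],
    impossible for so small an [s]. *)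
Lemma class_count_arith n d s N : 0 < n ->
    d * (3 * n) + 20 * N + 12 * s + 12 * N <= 12 * n + d * (12 * s) ->
    3 * n + 20 * s <= 12 * N -> 160 * s <= 3 * n ->
  d * (3 * n) < 160 * N.
Proof.
move=> n0 kd Nl small; rewrite ltnNge; apply/negP => Nd.
have d14 : 14 <= d.
  rewrite leqNgt; apply/negP => d13.
  have : d * (3 * n) <= 13 * (3 * n) by rewrite leq_mul2r; lia.
  lia.
have : (d - 14) * (12 * s) <= (d - 14) * (3 * n) by rewrite leq_mul2l; lia.
move: kd; rewrite -{1 2}(subnKC d14) !mulnDl; lia.
Qed.

(** If all classes were below a quarter, a first count would push them all down to [3 * n / 160].
    The transversal of [v] would then cover at most [d * 3 * n / 160] vertices, fewer than the
    3-neighbours that a second count provides. *)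
Lemma maximal_large_class f : 2000 <= #|V| -> maximal f ->
  exists v, #|V| <= 4 * #|cls f v|.
Proof.
move=> n_large mf; have Nlarge v := maximal_nbr_large v n_large mf.
case: (boolP [exists v, #|V| <= 4 * #|cls f v|]) => [/existsP//|/existsPn small].
have {}small v : 4 * #|cls f v| < #|V| by rewrite ltnNge small.
have key v : exists d, [/\ 0 < d,
    d * (3 * #|V|) + 20 * #|nbr f v| + 12 * #|cls f v| + 12 * #|nbr f v|
      <= 12 * #|V| + d * (12 * #|cls f v|)
    & forall m, (forall t, 160 * #|cls f t| <= m) -> 160 * #|nbr f v| <= d * m].
  have [T [TN cov disj]] := maximal_transversal v mf.
  exists #|T|; split.
  - rewrite lt0n; apply: contraTneq (Nlarge v) => /eqP; rewrite cards_eq0 => /eqP T0.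
    by move: cov; rewrite T0 big_set0 leqn0 => /eqP->; lia.
  (* The degree bound is summed over [T]; each [t] has at most [#|cls f v|] of its 3-neighbours in
     the class of [v]. *)
  - have : #|T| * (3 * #|V|) + 20 * \sum_(t in T) #|cls f t|
           <= 12 * \sum_(t in T) #|nbr f t :\: cls f v| + #|T| * (12 * #|cls f v|).
      rewrite -!sum_nat_const !big_distrr -!big_split; apply: leq_sum => t _ /=.
      apply: leq_trans (Nlarge t) _; rewrite -mulnDr leq_mul2l /=.
      rewrite -(cardsID (cls f v) (nbr f t)) addnC leq_add2l.
      by rewrite subset_leq_card // subsetIr.
    by lia.
  - move=> m hm; apply: leq_trans (_ : 160 * \sum_(t in T) #|cls f t| <= _).
      by rewrite leq_mul2l.
    by rewrite big_distrr -sum_nat_const; apply: leq_sum.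
have tiny v : 160 * #|cls f v| <= 3 * #|V|.
  have [d [d0 kd _]] := key v; apply: (class_bound_arith d0 kd) => //; exact: ltnW.
have [v _] : exists v, v \in V by apply/card_gt0P; exact: leq_trans n_large.
have [d [_ kd /(_ _ tiny) Nd]] := key v.
have nv := Nlarge v; have sv := tiny v.
have lt := class_count_arith (leq_trans (isT : 0 < 2000) n_large) kd nv sv.
by have := leq_ltn_trans Nd lt; rewrite ltnn.
Qed.

(* Once the class of v consists of clones of v, no vertex can have weight 2
   towards v: its 3-neighbours of v would lie in a single class, which would
   be too large. *)
Lemma maximal_le_split f : 2000 <= #|V| -> maximal f ->
  exists L, total f <= total (split_weight L).
Proof.
move=> n_large mf0; have [v vlarge] := maximal_large_class n_large mf0.
have /admissibleP[k1 k2 k3 k4 k5] := mf0.1.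
have fA : {in cls f v &, forall x y, f x y = 1}.
  move=> x y; rewrite !inE => /eqP vx /eqP vy.
  by apply: (maximal_trans (y := v) mf0); rewrite // k2.
pose p x := if x \in cls f v then v else x.
pose g x y := f (p x) (p y).
have gv x : g v x = f v x.
  rewrite /g /p [v \in _]inE k1 eqxx; case: ifP => //; rewrite inE => /eqP->.
  exact: k1.
(* Vertices of one class have equal degrees, so this cloning loses nothing. *)
have mg : maximal g.
  apply: maximal_clone => //; rewrite -prod_nat_const; apply: leq_prod => x.
  rewrite inE => /eqP vx; rewrite -(maximal_deg_eq mf0 vx) /deg.
  rewrite (bigID (mem (cls f v))) /= big1 ?mul1n => [|y]; last first.
    by rewrite inE => /eqP.
  by apply: eq_leq; apply: eq_bigl => y; rewrite in_setC.
have gcls : cls g v = cls f v by apply/setP => x; rewrite !inE gv.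
have gclone x y : g v x = 1 -> g x y = g v y.
  rewrite gv => vx; rewrite /g; congr (f _ _).
  by rewrite /p !inE k1 vx eqxx.
rewrite -gcls in vlarge.
have /admissibleP[h1 h2 h3 h4 h5] := mg.1.
have no2 u : g v u <> 2.
  move=> vu.
  have Nv := maximal_nbr_large v n_large mg.
  have Nu := maximal_nbr_large u n_large mg.
  pose U := ~: (cls g v :|: nbr g v).
  have cU : #|U| + #|cls g v| + #|nbr g v| = #|V|.
    by rewrite -(cardsC (cls g v :|: nbr g v)) card_clsU_nbr [RHS]addnC addnA.
  (* The class of [v] contains no 3-neighbour of [u], since its members are clones of [v] and have
     weight 2 towards [u]. *)
  have NuS : nbr g u \subset U :|: (nbr g u :&: nbr g v).
    apply/subsetP => x; rewrite !inE => ux; rewrite ux /= orbC.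
    case: (g v x =P 3) => //= _; rewrite orbF; apply/eqP => vx.
    by move: ux; rewrite h2 (gclone x u vx) vu.
  have cNu : #|nbr g u| <= #|U| + #|nbr g u :&: nbr g v|.
    by apply: leq_trans (subset_leq_card NuS) _; apply: leq_card_setU.
  have [x] : exists x, x \in nbr g u :&: nbr g v by apply/card_gt0P; lia.
  rewrite !inE => /andP[/eqP ux /eqP vx].
  have Nx := maximal_nbr_large x n_large mg.
  (* In the 4-cycle [v x u y] the diagonal [v u] has weight 2, so [x y] has weight 1. *)
  have cx : #|nbr g u :&: nbr g v| <= #|cls g x|.
    apply: subset_leq_card; apply/subsetP => y; rewrite !inE => /andP[/eqP uy /eqP vy].
    by case: (h5 v x u y); rewrite ?(h2 x u) ?(h2 y v) ?vu // => ->.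
  have xv : #|nbr g x| + #|nbr g v| <= #|V|.
    have -> : #|nbr g x| + #|nbr g v| = #|nbr g x :|: nbr g v|.
      rewrite cardsU; have -> : nbr g x :&: nbr g v = set0; last by rewrite cards0 subn0.
      apply/setP => y; rewrite !inE; apply/negP => /andP[/eqP xy /eqP vy].
      exact: (h4 v x y).
    exact: max_card.
  (* As the class of [v] has at least [n / 4] vertices, [v] has at least [2 * n / 3] 3-neighbours
     and [U] at most [n / 12] elements. So the class of [x] has at least [n / 6] vertices, and [x]
     more than [n / 3] 3-neighbours, against [xv]. *)
  lia.
exists (cls g v); apply: leq_trans (_ : total g <= _); first exact: mg.2 mf0.1.
(* The comparison is pointwise: two vertices outside the class are both 3-neighbours of [v], so a
   weight 3 between them would close a triangle. *)
apply: leq_prod => x _; apply: leq_prod => y _; rewrite /split_weight.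
case: eqVneq => [->|xy]; first by rewrite h1.
have N3 z : z \notin cls g v -> g v z = 3.
  rewrite inE; have := h3 v z; have := @no2 z.
  by case: (g v z) => [|[|[|[|?]]]].
have [xC|/N3 vx] := boolP (x \in cls g v); have [yC|/N3 vy] := boolP (y \in cls g v).
- by move: xC yC; rewrite !inE => /eqP vx /eqP vy; rewrite (gclone x y vx) vy.
- by case/andP: (h3 x y).
- by case/andP: (h3 x y).
- have := h3 x y; have := @h4 x v y; rewrite h2 => /(_ vx vy).
  by case: (g x y) => [|[|[|[|?]]]].
Qed.

End Weightings.

(** * Passing between multigraphs and weightings *)

Section Multigraphs.

Variable V : finType.
Implicit Types (w : multigraph V) (A L : {set V}).

(** Each edge arises from exactly two ordered pairs. A general commutative law covers both the
    product [P] and the span sums. *)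
Lemma big_edges (R : Type) (idx : R) (op : Monoid.com_law idx) A
    (F : V -> V -> R) (w : edge V -> R) :
    (forall e x y, val e = [set x; y] -> F x y = w e) ->
  \big[op/idx]_(p | [&& p.1 != p.2, p.1 \in A & p.2 \in A]) F p.1 p.2
  = \big[op/idx]_(e : edge V | val e \subset A) op (w e) (w e).
Proof.
move=> Fw.
pose ends (p : V * V) := [set p.1; p.2].
transitivity (\big[op/idx]_(p | [&& p.1 != p.2, p.1 \in A & p.2 \in A])
    \big[op/idx]_(e : edge V | val e == ends p) w e).
  apply: eq_bigr => p /andP[pD _].
  have ep : #|ends p| == 2 by rewrite cards2 pD.
  pose e : edge V := exist _ (ends p) ep.
  by rewrite (big_pred1 e) => [|e']; [apply: Fw | rewrite -val_eqE].
rewrite (exchange_big_dep (fun e : edge V => val e \subset A)) /=; last first.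
  by move=> p e /and3P[_ p1 p2] /eqP ->; rewrite subUset !sub1set p1 p2.
apply: eq_bigr => e eA; have /cards2P[x [y [xDy exy]]] := valP e.
have [xA yA] : x \in A /\ y \in A.
  by apply/andP; move: eA; rewrite exy subUset !sub1set.
rewrite (bigD1 (x, y)) /=; last by rewrite xDy xA yA exy eqxx.
rewrite (big_pred1 (y, x)) // => -[a b] /=; rewrite exy /ends /= !xpair_eqE.
apply/idP/idP => [/andP[/andP[/and3P[aDb _ _] /eqP abE] /negP ne]|].
  have /set2P[aE|aE] : a \in [set x; y] by rewrite abE set21.
    have /set2P[bE|bE] : b \in [set x; y] by rewrite abE set22.
      by move: aDb; rewrite aE bE eqxx.
    by case: ne; rewrite aE bE !eqxx.
  have /set2P[bE|bE] : b \in [set x; y] by rewrite abE set22.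
    by rewrite aE bE !eqxx.
  by move: aDb; rewrite aE bE eqxx.
by move=> /andP[/eqP-> /eqP->]; rewrite (eq_sym y x) (negPf xDy) xA yA setUC eqxx.
Qed.

(** For [x = y] the set is a singleton, [insub] fails, and the default 1 supplies the diagonal. *)
Definition weighting w x y : nat := oapp w 1 (insub [set x; y]).

Lemma weightingE w (e : edge V) x y : val e = [set x; y] -> weighting w x y = w e.
Proof. by rewrite /weighting => <-; rewrite valK. Qed.

Lemma weightingxx w x : weighting w x x = 1.
Proof. by rewrite /weighting insubN // setUid cards1. Qed.

Lemma weightingC w x y : weighting w x y = weighting w y x.
Proof. by rewrite /weighting setUC. Qed.

Lemma weighting_edge w x y : x != y ->
  exists2 e : edge V, val e = [set x; y] & weighting w x y = w e.
Proof.
move=> xDy; have exy : #|[set x; y]| == 2 by rewrite cards2 xDy.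
pose e : edge V := exist _ [set x; y] exy.
by exists e => //; apply: weightingE.
Qed.

Lemma total_weighting w : total (weighting w) = P w ^ 2.
Proof.
rewrite /total /deg pair_big /= (bigID (fun p => p.1 != p.2)) /=.
rewrite [X in _ * X]big1 ?muln1 => [|[x y] /negPn/eqP /= ->]; last exact: weightingxx.
rewrite (eq_bigl (fun p => [&& p.1 != p.2, p.1 \in setT & p.2 \in setT])) => [|p].
  rewrite (@big_edges _ _ muln setT _ _ (@weightingE w)) /P -mulnn -big_split /=.
  by apply: eq_bigl => e; rewrite subsetT.
by rewrite !in_setT !andbT.
Qed.

Lemma sum_weighting w A :
  \sum_(x in A) \sum_(y in A) weighting w x y = 2 * span_weight w A + #|A|.
Proof.
rewrite pair_big /= (bigID (fun p => p.1 != p.2)) /=; congr (_ + _).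
  have := @big_edges _ _ addn A (weighting w) w (@weightingE w).
  rewrite mul2n -addnn /span_weight -big_split /= => <-.
  by apply: eq_bigl => p; rewrite andbC.
rewrite -sum1_card (reindex_onto (fun x => (x, x)) fst) /=; last first.
  by move=> [x y] /andP[_ /negPn/eqP /= ->].
by apply: eq_big => x; rewrite ?eqxx ?andbT ?andbb // => _; rewrite weightingxx.
Qed.

(** A triangle of 3-edges would span 9; a 4-cycle of them spans 12, leaving at most 3 for its two
    positive diagonals. *)
Lemma admissible_weighting w : 0 < P w -> sq_graph 4 15 w -> mu w <= 3 ->
  sq_graph 3 8 w -> admissible (weighting w).
Proof.
move=> Pw w4 w3 w2.
have pos (e : edge V) : 0 < w e <= 3.
  rewrite (leq_trans _ w3) ?andbT; last exact: (leq_bigmax (F := w) e).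
  by rewrite lt0n; apply: contraTneq Pw => e0; rewrite /P (bigD1 e) //= e0.
have wpos x y : 0 < weighting w x y <= 3.
  have [->|/(weighting_edge w)[e _ ->]] := eqVneq x y; first by rewrite weightingxx.
  exact: pos.
have ne x y : weighting w x y <> 1 -> x != y.
  by case: eqVneq => // ->; rewrite weightingxx.
apply/admissibleP; split=> //; [exact: weightingxx | exact: weightingC | |].
- move=> x y z xy yz xz.
  have xDy : x != y by apply: ne; rewrite xy.
  have yDz : y != z by apply: ne; rewrite yz.
  have xDz : x != z by apply: ne; rewrite xz.
  have cA : #|x |: (y |: [set z])| = 3.
    by rewrite !cardsU1 cards1 !inE negb_or xDy xDz yDz.
  have := sum_weighting w (x |: (y |: [set z])); rewrite cA.
  rewrite !(big_setU1, big_set1) ?inE ?negb_or ?xDy ?xDz //=.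
  rewrite !weightingxx (weightingC w y x) (weightingC w z) (weightingC w z y) xy yz xz.
  have := w2 _ cA; lia.
- move=> x y z t xy yz zt tx.
  have [xz1|/eqP xz] := eqVneq (weighting w x z) 1; first by left.
  have [yt1|/eqP yt] := eqVneq (weighting w y t) 1; first by right.
  have xDz := ne _ _ xz; have yDt := ne _ _ yt.
  have xDy : x != y by apply: ne; rewrite xy.
  have yDz : y != z by apply: ne; rewrite yz.
  have zDt : z != t by apply: ne; rewrite zt.
  have xDt : x != t by apply: ne; rewrite weightingC tx.
  have cA : #|x |: (y |: (z |: [set t]))| = 4.
    by rewrite !cardsU1 cards1 !inE !negb_or xDy xDz xDt yDz yDt zDt.
  have := sum_weighting w (x |: (y |: (z |: [set t]))); rewrite cA.
  rewrite !(big_setU1, big_set1) ?inE ?negb_or ?xDy ?xDz ?xDt ?yDz ?yDt //=.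
  rewrite !weightingxx (weightingC w y x) (weightingC w z x) (weightingC w z y).
  rewrite (weightingC w x t) (weightingC w t y) (weightingC w t z) xy yz zt tx.
  have := w4 _ cA; have := wpos x z; have := wpos y t; lia.
Qed.

Definition split_graph L : multigraph V :=
  [ffun e : edge V => if val e \subset L then 1
                      else if val e \subset ~: L then 2 else 3].

Lemma weighting_split_graph L x y :
  weighting (split_graph L) x y = split_weight L x y.
Proof.
have [->|xDy] := eqVneq x y; first by rewrite weightingxx /split_weight eqxx.
have [e eE ->] := weighting_edge (split_graph L) xDy.
rewrite ffunE eE !subUset !sub1set !inE /split_weight (negPf xDy).
by case: (x \in L); case: (y \in L).
Qed.

(** The extra [#|A :\: L|] on the left raises the diagonal outside [L] from 1 to 2, which makes the
    right side a plain quadratic form. *)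
Lemma sum_split_weight L A :
  \sum_(x in A) \sum_(y in A) split_weight L x y + #|A :\: L|
  = #|A :&: L| ^ 2 + 6 * (#|A :&: L| * #|A :\: L|) + 2 * #|A :\: L| ^ 2.
Proof.
have sumA (F : V -> nat) : \sum_(x in A) F x
    = \sum_(x in A :&: L) F x + \sum_(x in A :\: L) F x.
  rewrite (bigID (mem L)) /=; congr (_ + _); apply: eq_bigl => x.
    by rewrite !inE.
  by rewrite !inE andbC.
rewrite !sumA -addnA -[X in _ + (_ + X)]sum1_card -big_split /=.
rewrite (eq_bigr (fun=> #|A :&: L| * 1 + #|A :\: L| * 3)) => [|x]; last first.
  rewrite inE => /andP[_ xL]; rewrite sumA -!sum_nat_const.
  congr (_ + _); apply: eq_bigr => y; rewrite !inE /split_weight xL.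
    by move=> /andP[_ ->]; case: eqP.
  by move=> /andP[yL _]; rewrite (negPf yL); case: eqVneq xL yL => // -> ->.
rewrite [X in _ + X](eq_bigr (fun=> #|A :&: L| * 3 + #|A :\: L| * 2)) => [|x xAL].
  by rewrite !sum_nat_const; lia.
rewrite sumA -addnA -!sum_nat_const; have := xAL; rewrite inE => /andP[xL xA].
congr (_ + _).
  apply: eq_bigr => y; rewrite inE => /andP[_ yL].
  by rewrite /split_weight yL (negPf xL); case: eqVneq yL xL => // -> ->.
rewrite (bigD1 x) //= [RHS](bigD1 x) //= {1}/split_weight eqxx.
rewrite [in LHS](eq_bigr (fun=> 2)); first by lia.
move=> y /andP[]; rewrite inE => /andP[yL _] yDx.
by rewrite /split_weight eq_sym (negPf yDx) (negPf xL) (negPf yL).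
Qed.

Lemma span_split_graph L w A :
    (forall x y, weighting w x y = split_weight L x y) ->
  2 * span_weight w A + #|A| + #|A :\: L|
  = #|A :&: L| ^ 2 + 6 * (#|A :&: L| * #|A :\: L|) + 2 * #|A :\: L| ^ 2.
Proof.
move=> wE; rewrite -sum_split_weight -sum_weighting; congr (_ + _).
by apply: eq_bigr => x _; apply: eq_bigr => y _; rewrite wE.
Qed.

Lemma leq_P w w' : total (weighting w) <= total (weighting w') -> P w <= P w'.
Proof. by rewrite !total_weighting leq_exp2r. Qed.

End Multigraphs.

(** * The families [W] and [D], and the conclusion *)

Lemma W_weighting n (w : multigraph 'I_n) : W w ->
  exists L, forall x y, weighting w x y = split_weight L x y.
Proof.
move=> [L [R [[LR LRd] wL wR wLR]]]; exists L => x y.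
have inR z : z \notin L -> z \in R.
  by move=> zL; have := in_setT z; rewrite -LR inE (negPf zL).
have [->|xDy] := eqVneq x y; first by rewrite weightingxx /split_weight eqxx.
have [e eE ->] := weighting_edge w xDy; rewrite /split_weight (negPf xDy).
have [xL|/inR xR] := boolP (x \in L); have [yL|/inR yR] := boolP (y \in L) => /=.
- by apply: wL; rewrite eE subUset !sub1set xL.
- exact: (wLR e x y).
- by apply: (wLR e y x); rewrite // eE setUC.
- by apply: wR; rewrite eE subUset !sub1set xR.
Qed.

Lemma W_split_graph n (L : {set 'I_n}) : W (split_graph L).
Proof.
exists L, (~: L); split.
- by split; [rewrite setUCr | rewrite disjoints_subset setCK].
- by move=> e eL; rewrite ffunE eL.
- move=> e eL; rewrite ffunE eL; case: ifP => // eL'.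
  have /cards2P[x [y [_ exy]]] := valP e.
  move: eL eL'; rewrite exy !subUset !sub1set !inE => /andP[xL _] /andP[xL' _].
  by rewrite xL' in xL.
- move=> e x y xL; rewrite inE => yL eE.
  by rewrite ffunE eE !subUset !sub1set !inE xL (negPf yL).
Qed.

(** Four vertices span at most 15, attained with one or two of them in [L]; three span at most 8,
    attained with one in [L]. *)
Lemma W_sub_D n (w : multigraph 'I_n) : W w -> D w.
Proof.
move=> /W_weighting[L wE].
have split_card (A : {set 'I_n}) : #|A| = #|A :&: L| + #|A :\: L|.
  by rewrite cardsID.
split; [split|].
- move=> A A4; have := span_split_graph A wE; have := split_card A; rewrite A4.
  move: #|A :&: L| #|A :\: L| => a b.
  by case: a => [|[|[|[|[|a]]]]] e; have {}e := esym e; lia.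
- apply/bigmax_leqP => e _; have /cards2P[x [y [_ /weightingE <-]]] := valP e.
  by rewrite wE /split_weight; do !case: ifP.
- move=> A A3; have := span_split_graph A wE; have := split_card A; rewrite A3.
  move: #|A :&: L| #|A :\: L| => a b.
  by case: a => [|[|[|[|a]]]] e; have {}e := esym e; lia.
Qed.

Theorem theorem4p3 :
  exists n0 : nat, forall n : nat, n0 <= n ->
    exists G : multigraph 'I_n,
      maximizes_P (@D n) G /\ maximizes_P (@W n) G.
Proof.
(* The threshold makes a quarter of the vertices at least 500. *)
exists 2000 => n n_large.
pose L := [arg max_(L > set0 : {set 'I_n}) total (split_weight L)].
have Lmax (L' : {set 'I_n}) : total (split_weight L') <= total (split_weight L).
  by rewrite /L; case: arg_maxnP => // L0 _; apply.
have totalE (w : multigraph 'I_n) (L' : {set 'I_n}) :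
    (forall x y, weighting w x y = split_weight L' x y) ->
    total (weighting w) = total (split_weight L').
  by move=> wE; apply: eq_bigr => x _; apply: eq_bigr => y _; rewrite wE.
exists (split_graph L); split; split; try exact: W_split_graph.
- exact/W_sub_D/W_split_graph.
(* A zero product is no competitor; a positive one makes all weights positive, as admissibility
   demands. *)
- move=> w [[w4 w3] w2]; case: (posnP (P w)) => [->//|Pw].
  apply: leq_P; rewrite (totalE _ _ (weighting_split_graph L)).
  have [g mg le] := maximal_exists (admissible_weighting Pw w4 w3 w2).
  have n2000 : 2000 <= #|'I_n| by rewrite card_ord.
  have [L' le'] := maximal_le_split n2000 mg.
  exact: leq_trans le (leq_trans le' (Lmax L')).
- move=> w /W_weighting[L' wE]; apply: leq_P.
  by rewrite (totalE _ _ (weighting_split_graph L)) (totalE _ _ wE).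
Qed.
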